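(* Let $G$ be a connected semisimple Lie group with Lie algebra $\mathfrak{g}$. Consider the left action of $G$ on $T^*(G)\approx G\times\mathfrak{g}^*$ given by $g\cdot(h,\alpha)=(gh,\alpha)$ and the right action of $G$ on $G\times\mathfrak{g}^*$ given by $g\cdot(h,\alpha)=(hg^{-1},\mathrm{Ad}^*(g)(\alpha))$. For each of these two actions, the only orbits that are isotropic are those of the form $G(g,0)$ with $g\in G$. Such orbits are Lagrangian and Hamiltonian isotopic to $G$ (the zero section $G\times\{0\}$).
   Context: The cotangent bundle $T^*(G)$ is identified with $G\times\mathfrak{g}^*$ by $\lambda(g,\alpha_g)=(g,\alpha_g\circ(dL_g)_e)$, where $L_g$ is left multiplication by $g$. The canonical symplectic form $-d\theta_0$ ($\theta_0$ the Liouville 1-form) becomes, on $G\times\mathfrak{g}^*$, $$\omega_{(g,\alpha)}((v,\beta),(u,\gamma))=\gamma((dL_{g^{-1}})_g v)-\beta((dL_{g^{-1}})_g u)+\alpha([(dL_{g^{-1}})_g v,(dL_{g^{-1}})_g u])$$ for $v,u\in T_gG$ and $\beta,\gamma\in\mathfrak{g}^*$. The two actions are the cotangent lifts of left multiplication $(g,h)\mapsto gh$ and of $(g,h)\mapsto hg^{-1}$. The coadjoint representation is $\mathrm{Ad}^*(g)\alpha=\alpha\circ\mathrm{Ad}(g^{-1})$. A submanifold is isotropic if the symplectic form restricts to zero on it, and Lagrangian if moreover its dimension is half the dimension of the ambient manifold. *)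

(* Defs.v *)
From mathcomp Require Import all_boot all_order all_algebra.
From mathcomp Require Import all_classical all_reals all_analysis.

Set Implicit Arguments.
Unset Strict Implicit.
Unset Printing Implicit Defensive.

Import Order.TTheory GRing.Theory Num.Theory.
Import numFieldNormedType.Exports.
Local Open Scope classical_set_scope.
Local Open Scope ring_scope.

(** ** Smooth functions between finite-dimensional normed spaces

    [Ck k U f] says that [f] is of class C^k on the open set [U]: it is
    differentiable on [U] and each of its directional derivatives is of class
    C^(k-1).  It is only used for finite-dimensional spaces, where this is the
    usual notion. *)
Fixpoint Ck (R : realType) (V W : normedModType R) (k : nat)
    (U : set V) (f : V -> W) : Prop :=
  match k with
  | 0%N => forall x, U x -> {for x, continuous f}
  | k'.+1 => (forall x, U x -> differentiable f x) /\
             (forall v, Ck k' U (fun x => 'd f x v))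
  end.

Definition smooth_on (R : realType) (V W : normedModType R)
    (U : set V) (f : V -> W) : Prop := forall k, Ck k U f.

(** ** Manifolds

    A manifold modelled on [V] comes with a preferred chart around each of its
    points [x], of domain [chart_dom x], and the atlas consists of these charts
    (every atlas can be presented in this way).  Outside [chart_dom x],
    resp. outside the image of the chart, the values of [chart_map x],
    resp. [chart_inv x], are irrelevant. *)
Record charted (R : realType) (V : normedModType R) := Charted {
  carrier :> topologicalType ;
  chart_dom : carrier -> set carrier ;
  chart_map : carrier -> carrier -> V ;
  chart_inv : carrier -> V -> carrier }.
Arguments chart_dom {R V} c.
Arguments chart_map {R V} c.
Arguments chart_inv {R V} c.

Definition is_chart (R : realType) (V : normedModType R) (M : topologicalType)
    (D : set M) (phi : M -> V) (psi : V -> M) : Prop :=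
  [/\ open D, open (phi @` D),
      forall y, D y -> psi (phi y) = y,
      forall y, D y -> {for y, continuous phi} &
      forall u, (phi @` D) u -> {for u, continuous psi}].

Record is_manifold (R : realType) (V : normedModType R) (M : charted V) : Prop :=
  IsManifold {
    manifold_hausdorff : hausdorff_space M ;
    manifold_second_countable : @second_countable M ;
    manifold_chart : forall x : M,
      is_chart (chart_dom M x) (chart_map M x) (chart_inv M x) ;
    manifold_cover : forall x : M, chart_dom M x x ;
    manifold_compat : forall x y : M,
      smooth_on (chart_map M x @` (chart_dom M x `&` chart_dom M y))
                (chart_map M y \o chart_inv M x) }.

Definition smooth_map (R : realType) (V W : normedModType R)
    (M : charted V) (N : charted W) (f : M -> N) : Prop :=
  continuous f /\
  forall (x : M) (y : N),
    smooth_on (chart_map M x @` (chart_dom M x `&` f @^-1` chart_dom N y))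
              (chart_map N y \o f \o chart_inv M x).

(** The tangent space of [M] at [x] is the model space [V], a vector [v : V]
    standing for the tangent vector with coordinates [v] in the preferred chart
    at [x].  Accordingly the differential of [f] at [x] is read in the
    preferred charts at [x] and [f x]. *)
Definition mdiff (R : realType) (V W : normedModType R)
    (M : charted V) (N : charted W) (f : M -> N) (x : M) : V -> W :=
  'd (chart_map N (f x) \o f \o chart_inv M x) (chart_map M x x).

Definition vect_charted (R : realType) (V : normedModType R) : charted V :=
  @Charted R V V (fun _ => setT) (fun _ => id) (fun _ => id).

Definition prod_charted (R : realType) (V W : normedModType R)
    (M : charted V) (N : charted W) : charted (V * W)%type :=
  @Charted R (V * W)%type (M * N)%type
    (fun x => chart_dom M x.1 `*` chart_dom N x.2)
    (fun x y => (chart_map M x.1 y.1, chart_map N x.2 y.2))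
    (fun x u => (chart_inv M x.1 u.1, chart_inv N x.2 u.2)).

Definition real_line (R : realType) : charted R^o := vect_charted R^o.

(** A vector field assigns to each point a tangent vector; [field_in_chart X p]
    is its expression in the preferred chart at [p], and the bracket at [p] is
    DY(X) - DX(Y) computed in that chart. *)
Definition field_in_chart (R : realType) (V : normedModType R) (M : charted V)
    (X : M -> V) (p : M) : V -> V :=
  fun u => let q := chart_inv M p u in
    'd (chart_map M p \o chart_inv M q) (chart_map M q q) (X q).

Definition field_bracket (R : realType) (V : normedModType R) (M : charted V)
    (X Y : M -> V) (p : M) : V :=
  let X' := field_in_chart X p in
  let Y' := field_in_chart Y p in
  let u := chart_map M p p in
  'd Y' u (X' u) - 'd X' u (Y' u).

(** ** Lie groups *)
Record lieGroup (R : realType) (n : nat) := LieGroup {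
  lie_charted :> charted 'rV[R]_n ;
  lie_mul : lie_charted -> lie_charted -> lie_charted ;
  lie_inv : lie_charted -> lie_charted ;
  lie_one : lie_charted ;
  lie_manifold : is_manifold lie_charted ;
  lie_mulA : associative lie_mul ;
  lie_mul1 : left_id lie_one lie_mul ;
  lie_mulr1 : right_id lie_one lie_mul ;
  lie_mulV : left_inverse lie_one lie_inv lie_mul ;
  lie_mulrV : right_inverse lie_one lie_inv lie_mul ;
  lie_smooth_mul :
    smooth_map (M := prod_charted lie_charted lie_charted) (N := lie_charted)
      (fun p => lie_mul p.1 p.2) ;
  lie_smooth_inv : smooth_map lie_inv }.
Arguments lie_mul {R n} l.
Arguments lie_inv {R n} l.
Arguments lie_one {R n} l.

(** The Lie algebra is the tangent space at the identity, with the bracket of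
    left-invariant vector fields. *)
Definition left_invariant (R : realType) (n : nat) (G : lieGroup R n)
    (X : 'rV[R]_n) : G -> 'rV[R]_n :=
  fun g => mdiff (lie_mul G g) (lie_one G) X.

Definition lie_bracket (R : realType) (n : nat) (G : lieGroup R n)
    (X Y : 'rV[R]_n) : 'rV[R]_n :=
  field_bracket (left_invariant (G := G) X) (left_invariant (G := G) Y)
    (lie_one G).

Definition Ad (R : realType) (n : nat) (G : lieGroup R n) (g : G) :
    'rV[R]_n -> 'rV[R]_n :=
  mdiff (fun h => lie_mul G (lie_mul G g h) (lie_inv G g)) (lie_one G).

Definition lie_ideal (R : realType) (n : nat)
    (br : 'rV[R]_n -> 'rV[R]_n -> 'rV[R]_n) (I : {vspace 'rV[R]_n}) : Prop :=
  forall x y, y \in I -> br x y \in I.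

Definition simple_lie_subalgebra (R : realType) (n : nat)
    (br : 'rV[R]_n -> 'rV[R]_n -> 'rV[R]_n) (I : {vspace 'rV[R]_n}) : Prop :=
  (exists x y, [/\ x \in I, y \in I & br x y != 0]) /\
  (forall J : {vspace 'rV[R]_n}, (J <= I)%VS ->
     (forall x y, x \in I -> y \in J -> br x y \in J) -> J = 0%VS \/ J = I).

(** Semisimple means: direct sum of simple Lie algebras (possibly none). *)
Definition semisimple_bracket (R : realType) (n : nat)
    (br : 'rV[R]_n -> 'rV[R]_n -> 'rV[R]_n) : Prop :=
  exists (m : nat) (I : 'I_m -> {vspace 'rV[R]_n}),
    [/\ forall i, lie_ideal br (I i),
        forall i, simple_lie_subalgebra br (I i),
        directv (\sum_i I i)%VS &
        (\sum_i I i)%VS = fullv].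

Definition semisimple (R : realType) (n : nat) (G : lieGroup R n) : Prop :=
  semisimple_bracket (lie_bracket G).

(** ** The cotangent bundle, as G x g^*

    A linear form on row vectors is given by the column vector of its
    values on the canonical basis. *)
Definition pairing (R : realType) (n : nat) (a : 'cV[R]_n) (v : 'rV[R]_n) : R :=
  (v *m a) 0 0.

Definition form_col (R : realType) (n : nat) (f : 'rV[R]_n -> R) : 'cV[R]_n :=
  \col_i f (delta_mx 0 i).

Definition coAd (R : realType) (n : nat) (G : lieGroup R n) (g : G)
    (a : 'cV[R]_n) : 'cV[R]_n :=
  form_col (fun v => pairing a (Ad (lie_inv G g) v)).

Definition cotangent (R : realType) (n : nat) (G : lieGroup R n) :
    charted ('rV[R]_n * 'cV[R]_n)%type :=
  prod_charted G (vect_charted 'cV[R]_n).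

(** The differential at [g] of left multiplication by [g^-1]. *)
Definition left_triv (R : realType) (n : nat) (G : lieGroup R n) (g : G) :
    'rV[R]_n -> 'rV[R]_n :=
  mdiff (lie_mul G (lie_inv G g)) g.

Definition omega (R : realType) (n : nat) (G : lieGroup R n)
    (p : cotangent G) (w1 w2 : 'rV[R]_n * 'cV[R]_n) : R :=
  let v := left_triv p.1 w1.1 in
  let u := left_triv p.1 w2.1 in
  pairing w2.2 v - pairing w1.2 u + pairing p.2 (lie_bracket G v u).

Definition left_action (R : realType) (n : nat) (G : lieGroup R n)
    (g : G) (p : cotangent G) : cotangent G :=
  (lie_mul G g p.1, p.2).

Definition right_action (R : realType) (n : nat) (G : lieGroup R n)
    (g : G) (p : cotangent G) : cotangent G :=
  (lie_mul G p.1 (lie_inv G g), coAd g p.2).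

Definition zero_section (R : realType) (n : nat) (G : lieGroup R n) :
    set (cotangent G) := [set p | p.2 = 0].
Arguments zero_section {R n} G _.

(** ** Submanifolds and orbits

    Orbits need not be embedded, so submanifolds are immersed: a manifold with
    an injective immersion. *)
Record submanifold (R : realType) (V : normedModType R) (M : charted V) :=
  Submanifold {
    sub_dim : nat ;
    sub_charted :> charted 'rV[R]_sub_dim ;
    sub_incl : sub_charted -> M ;
    sub_manifold : is_manifold sub_charted ;
    sub_smooth : smooth_map sub_incl ;
    sub_injective : injective sub_incl ;
    sub_immersion : forall x, injective (mdiff sub_incl x) }.
Arguments sub_incl {R V M} s.

Definition orbit_of (A B : Type) (act : A -> B -> B) (x : B) : set B :=
  [set act a x | a in setT].

(** [L] is the orbit of [x] with its structure of submanifold: the one for which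
    the orbit map is smooth into the orbit.  That structure is unique, and
    identifies the orbit with the quotient of G by the stabilizer of [x]. *)
Definition is_orbit (R : realType) (n : nat) (G : lieGroup R n)
    (act : G -> cotangent G -> cotangent G) (x : cotangent G)
    (L : submanifold (cotangent G)) : Prop :=
  range (sub_incl L) = orbit_of act x /\
  exists pi : G -> L, smooth_map pi /\ forall g, sub_incl L (pi g) = act g x.

Definition isotropic (R : realType) (n : nat) (G : lieGroup R n)
    (L : submanifold (cotangent G)) : Prop :=
  forall (y : L) (w1 w2 : 'rV[R]_(sub_dim L)),
    omega (sub_incl L y) (mdiff (sub_incl L) y w1) (mdiff (sub_incl L) y w2) = 0.

Definition lagrangian (R : realType) (n : nat) (G : lieGroup R n)
    (L : submanifold (cotangent G)) : Prop :=
  isotropic L /\ (2 * sub_dim L = n + n)%N.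

(** ** Hamiltonian isotopies

    [Phi (t, _)] is the flow of the time-dependent Hamiltonian [H (t, _)], whose
    Hamiltonian vector field X is determined by omega(X, _) = dH.  Time ranges
    over the whole line; an isotopy parametrized by [0, 1] can be
    reparametrized so as to be constant near its ends. *)
Definition hamiltonian_isotopy (R : realType) (n : nat) (G : lieGroup R n)
    (H : prod_charted (real_line R) (cotangent G) -> real_line R)
    (Phi : prod_charted (real_line R) (cotangent G) -> cotangent G) : Prop :=
  [/\ smooth_map H, smooth_map Phi,
      forall x, Phi (0, x) = x,
      forall t : R, exists Psi : cotangent G -> cotangent G,
        [/\ smooth_map Psi, cancel (fun x => Phi (t, x)) Psi &
            cancel Psi (fun x => Phi (t, x))] &
      forall (t : R) (x : cotangent G) (w : 'rV[R]_n * 'cV[R]_n),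
        omega (Phi (t, x))
          (mdiff (M := real_line R) (fun s => Phi (s, x)) t 1) w =
        mdiff (N := real_line R) (fun y => H (t, y)) (Phi (t, x)) w].

Definition hamiltonian_isotopic (R : realType) (n : nat) (G : lieGroup R n)
    (S0 S1 : set (cotangent G)) : Prop :=
  exists H Phi, @hamiltonian_isotopy R n G H Phi /\
    [set Phi (1, x) | x in S0] = S1.

(* Main.v *)
Require Import Defs.
From HB Require Import structures.
From mathcomp Require Import all_boot all_order all_algebra.
From mathcomp Require Import all_classical all_reals all_analysis.

Set Implicit Arguments.
Unset Strict Implicit.
Unset Printing Implicit Defensive.

Import Order.TTheory GRing.Theory Num.Theory.
Import numFieldNormedType.Exports.
Local Open Scope classical_set_scope.
Local Open Scope ring_scope.

(** Both actions are free with orbits of dimension n.  An orbit through (h, a) can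
    be reparametrized as a section g |-> (g, s g) of the bundle G x g^*: for the
    left action s is the constant a, for the right action
    s g = Ad^*(g^-1) b with b = Ad^*(h) a, whose pairing with Y is b (Ad g Y).
    The tangent vectors of the orbit at (1, s 1) are the (v, ds v).  Inserting two
    of them in the symplectic form gives s 1 ([v, w]) for the left action, where
    ds = 0.  For the right action ds v = b o ad v, and the three terms of the form
    add up to b ([w, v]).  So if the orbit is isotropic, then a (or b) vanishes on
    all brackets, hence is zero because a semisimple Lie algebra is spanned by its
    brackets ([semisimple_perfect]).  This is the content of
    [left_isotropic_eq0] and [right_isotropic_eq0].

    Conversely the orbits of the points (g, 0) are all equal, as sets, to the zero
    section, along which the form vanishes ([zero_isotropic]).  Their dimension is
    n because both the inclusion, followed by the projection to G, and the section
    of the orbit have injective differentials ([zero_dim]).  As these orbits are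
    the zero section itself, the constant isotopy, with zero Hamiltonian, joins
    them to it.

    The main analytic input is that the derivative of Ad is ad
    ([is_diff_pairing_Ad]).  In the chart at the identity the bracket of
    left-invariant vector fields is the antisymmetrization of the mixed second
    derivative of the multiplication ([lie_bracketE]).  Expanding Ad as
    (x, y) |-> (x y) x^-1 to second order gives the same expression, up to
    exchanging the order of two derivatives: this is Schwarz's theorem
    ([diff_sym]), obtained from the mean value theorem.  Smoothness is only ever
    transported along affine changes of variables ([Ck_comp_affine]), and a
    composite of two general maps between manifolds is only differentiated once
    ([chart_expr_comp]). *)

(** * Differentials and functions of class C^k *)

Section NearDiff.
Context {R : realType} {V W : normedModType R}.

Lemma is_diffE (f df : V -> W) (x v : V) : is_diff x f df -> 'd f x v = df v.
Proof. by move=> h; rewrite -(@diff_val _ _ _ _ _ _ _ h). Qed.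

Lemma diff_compE (U : normedModType R) (f : U -> V) (g : V -> W) (x v : U) :
  differentiable f x -> differentiable g (f x) ->
  'd (g \o f) x v = 'd g (f x) ('d f x v).
Proof. by move=> df dg; rewrite [X in X v](diff_comp df dg). Qed.

Lemma diff_pairE (U : normedModType R) (f : U -> V) (g : U -> W) (x v : U) :
  differentiable f x -> differentiable g x ->
  'd (fun y => (f y, g y)) x v = ('d f x v, 'd g x v).
Proof. by move=> df dg; rewrite [X in X v](diff_pair df dg). Qed.

(** [diff] is defined by choice among linear maps, so that functions which agree
    near a point have the same differential there only by uniqueness of the
    differential.  It suffices to compare with the difference of the two. *)
Lemma near0_is_diff (e : V -> W) (x : V) :
  (\forall y \near x, e y = 0) -> is_diff x e (0 : V -> W).
Proof.
move=> e0.
have ex0 : e x = 0 by exact: (nbhs_singleton e0).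
have key : e \o shift x = cst (e x) + (0 : V -> W) +o_ 0 id.
  apply/eqaddoP => _/posnumP[eps]; near=> h.
  rewrite /= !fctE /= ex0 add0r subr0.
  have -> : e (h + x) = 0.
    near: h; move: e0.
    by rewrite [X in X -> _](near_shift 0 x) /= subr0.
  by rewrite normr0 mulr_ge0.
have d0 : 'd e x = (\0 : {linear V -> W}) :> (V -> W).
  by apply: diff_unique => //; exact: cst_continuous.
apply: DiffDef => //.
by apply/diff_locallyP; rewrite d0; split => //; exact: cst_continuous.
Unshelve. all: by end_near. Qed.

Lemma near_eq_is_diff (f g df : V -> W) (x : V) :
  (\forall y \near x, f y = g y) -> is_diff x f df -> is_diff x g df.
Proof.
move=> fg dfx.
have d0 : is_diff x (g - f) (0 : V -> W).
  apply: near0_is_diff; near=> y.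
  rewrite !fctE (_ : f y = g y) ?subrr//; near: y; exact: fg.
have -> : g = f + (g - f) by apply/funext => y; rewrite !fctE subrKC.
exact: is_diff_eq (is_diffD dfx d0) (addr0 df).
Unshelve. all: by end_near. Qed.

Lemma near_eq_differentiable (f g : V -> W) (x : V) :
  (\forall y \near x, f y = g y) -> differentiable f x -> differentiable g x.
Proof.
by move=> fg /differentiableP dfx; have [] := near_eq_is_diff fg dfx.
Qed.

Lemma near_eq_diff (f g : V -> W) (x : V) :
  (\forall y \near x, f y = g y) -> differentiable f x ->
  'd g x = 'd f x :> (V -> W).
Proof.
by move=> fg /differentiableP dfx; have [] := near_eq_is_diff fg dfx.
Qed.
End NearDiff.

Section CkTheory.
Context {R : realType}.
Implicit Types V W : normedModType R.

Lemma Ck_sub V W k (U U' : set V) (f : V -> W) :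
  U' `<=` U -> Ck k U f -> Ck k U' f.
Proof.
move=> sU; elim: k f => [|k IH] f /=; first by move=> cf x /sU/cf.
by case=> df ck; split=> [x /sU/df//|v]; apply: IH.
Qed.

Lemma open_near V (U : set V) (P : V -> Prop) x :
  open U -> U x -> (forall y, U y -> P y) -> \forall y \near x, P y.
Proof.
by move=> oU Ux UP; apply: filterS UP _; exact: open_nbhs_nbhs.
Qed.

(** Openness matters: the derivatives of [f] at a point of [U] depend on the values
    of [f] around that point. *)
Lemma Ck_eq V W k (U : set V) (f g : V -> W) :
  open U -> {in U, f =1 g} -> Ck k U f -> Ck k U g.
Proof.
move=> oU; elim: k f g => [|k IH] f g fg /=.
  move=> cf x Ux; rewrite /prop_for /continuous_at -(fg _ (mem_set Ux)).
  apply: cvg_trans (cf x Ux); apply: near_eq_cvg.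
  by apply: (open_near oU Ux) => y Uy; rewrite fg ?inE.
have near_fg x : U x -> \forall y \near x, f y = g y.
  by move=> Ux; apply: (open_near oU Ux) => y Uy; rewrite fg ?inE.
case=> df ck; split=> [x Ux|v].
  by apply: near_eq_differentiable (near_fg x Ux) (df x Ux).
apply: IH (ck v) => x /[1!inE] Ux.
by rewrite (near_eq_diff (near_fg x Ux) (df x Ux)).
Qed.

Lemma Ck_cst V W k (U : set V) (a : W) : Ck k U (fun=> a).
Proof.
elim: k a => [|k IH] a /=; first by move=> x _; exact: cvg_cst.
split=> [x _|v]; first exact: differentiable_cst.
rewrite (_ : (fun _ => _) = fun=> 0) //.
by apply/funext => x; rewrite (is_diffE v (is_diff_cst a x)).
Qed.

Lemma Ck_pair V W W' k (U : set V) (f : V -> W) (g : V -> W') :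
  open U -> Ck k U f -> Ck k U g -> Ck k U (fun x => (f x, g x)).
Proof.
move=> oU; elim: k f g => [|k IH] f g /=.
  by move=> cf cg x Ux; apply: cvg_pair; [exact: cf|exact: cg].
move=> [df ckf] [dg ckg]; split=> [x Ux|v].
  by apply: differentiable_pair; [exact: df|exact: dg].
apply: Ck_eq (IH _ _ (ckf v) (ckg v)) => // x /[1!inE] Ux.
by rewrite diff_pairE//; [exact: df|exact: dg].
Qed.

(** The differential of the affine map [A] does not depend on the point, so no
    product rule enters: every derivative of [f \o A] is a derivative of [f] in
    a fixed direction, composed with [A]. *)
Lemma Ck_comp_affine V' V W k (U : set V) (f : V -> W) (A dA : V' -> V) :
  open U -> (forall x, is_diff x A dA) ->
  Ck k U f -> Ck k (A @^-1` U) (f \o A).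
Proof.
move=> oU hA.
have cA : continuous A.
  by move=> x; apply/differentiable_continuous; apply: ex_diff.
have oU' : open (A @^-1` U) by apply: open_comp => // x _; exact: cA.
elim: k f => [|k IH] f /=.
  by move=> cf x Ux; apply: continuous_comp; [exact: cA|exact: cf].
case=> df ck; split=> [x Ux|v].
  by apply: differentiable_comp; [exact: ex_diff|exact: df].
apply: Ck_eq (IH _ (ck (dA v))) => // x /[1!inE] Ux /=.
have hAx := hA x.
rewrite [RHS]diff_compE; [|exact: ex_diff|exact: df].
by congr ('d f _ _); rewrite (is_diffE v hAx).
Qed.

Lemma Ck_affine V W k (U : set V) (A dA : V -> W) :
  (forall x, is_diff x A dA) -> Ck k U A.
Proof.
move=> hA; case: k => [|k] /=.
  by move=> x _; apply/differentiable_continuous; apply: ex_diff.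
split=> [x _|v]; first exact: ex_diff.
rewrite (_ : (fun _ => _) = fun=> dA v); first exact: Ck_cst.
apply/funext => x; have hAx := hA x.
exact: is_diffE.
Qed.

Lemma is_diff_linear V W (L : V -> W) (x : V) :
  linear L -> continuous L -> is_diff x L L.
Proof.
move=> linL cL.
pose LM := GRing.isLinear.Build _ _ _ _ _ linL.
pose f : {linear V -> W} := HB.pack L LM.
apply: DiffDef; first exact: (@linear_differentiable _ _ _ f).
exact: (@diff_lin _ _ _ f).
Qed.

Lemma is_diff_fst V W (p : V * W) : is_diff p fst fst.
Proof. by apply: is_diff_linear => // x; exact: cvg_fst. Qed.

Lemma is_diff_snd V W (p : V * W) : is_diff p snd snd.
Proof. by apply: is_diff_linear => // x; exact: cvg_snd. Qed.

Lemma is_diff_coord m n (M : 'M[R]_(m, n)) i j :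
  is_diff M (fun N : 'M[R]_(m, n) => N i j : R) (fun N => N i j).
Proof.
apply: is_diff_linear => [a A B|x]; first by rewrite !mxE.
exact: coord_continuous.
Qed.

Lemma is_diff_inl V W (c : W) (x : V) :
  is_diff x (fun u => (u, c)) (fun v => (v, 0)).
Proof. exact: (is_diff_pair (f := id) (g := cst c)). Qed.

Lemma is_diff_inr V W (c : V) (x : W) :
  is_diff x (fun u => (c, u)) (fun v => (0, v)).
Proof. exact: (is_diff_pair (f := cst c) (g := id)). Qed.

End CkTheory.

Lemma is_diff_sum (R : realType) (V W : normedModType R) n (x : V)
    (f df : 'I_n -> V -> W) :
  (forall k, is_diff x (f k) (df k)) ->
  is_diff x (fun u => \sum_k f k u) (fun v => \sum_k df k v).
Proof.
move=> h.
have -> : (fun u => \sum_k f k u) = \sum_k f k.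
  by apply/funext => u; rewrite fct_sumE.
have -> : (fun v => \sum_k df k v) = \sum_k df k.
  by apply/funext => v; rewrite fct_sumE.
apply: (big_ind2 (fun g dg => is_diff x g dg)) => //.
- exact: (is_diff_cst (0 : W) x).
- by move=> g dg g' dg' hg hg'; exact: is_diffD.
Qed.

Lemma linear_comb (R : realType) (V W : normedModType R)
    (L : {linear V -> W}) n (c : 'I_n -> R) (s : 'I_n -> V) :
  L (\sum_k c k *: s k) = \sum_k c k *: L (s k).
Proof. by rewrite linear_sum; apply: eq_bigr => k _; rewrite linearZ. Qed.

(** * Symmetry of second derivatives *)

Section Symmetry.
Context {R : realType}.
Implicit Types V W : normedModType R.

Lemma Ck_comp_linear V W W' k (U : set V) (f : V -> W) (L : W -> W') :
  open U -> (forall y, is_diff y L L) -> Ck k U f -> Ck k U (L \o f).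
Proof.
move=> oU hL; elim: k f => [|k IH] f /=.
  move=> cf x Ux; apply: continuous_comp; first exact: cf.
  by apply/differentiable_continuous; apply: ex_diff.
case=> df ck; split=> [x Ux|v].
  by apply: differentiable_comp; [exact: df|exact: ex_diff].
apply: Ck_eq (IH _ (ck v)) => // x /[1!inE] Ux /=.
rewrite [RHS]diff_compE; [|exact: df|exact: ex_diff].
by rewrite (is_diffE _ (hL _)).
Qed.

Lemma is_diff_line V (p v : V) (s : R) :
  is_diff s (fun t : R => p + t *: v) (fun t : R => t *: v).
Proof.
have -> : (fun t : R => p + t *: v) = cst p + *:%R ^~ v by [].
apply: is_diff_eq (is_diffD (is_diff_cst p s) (is_diff_scalel s v)) _.
exact: add0r.
Qed.

Lemma is_derive_line V W (g : V -> W) (p v : V) (s : R) :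
  differentiable g (p + s *: v) ->
  is_derive s (1 : R) (fun t : R => g (p + t *: v)) ('d g (p + s *: v) v).
Proof.
move=> dg; have l := is_diff_line p v s.
have dgl : differentiable (g \o (fun t : R => p + t *: v)) s.
  by apply: differentiable_comp => //; exact: ex_diff.
apply: DeriveDef; first exact: diff_derivable.
rewrite deriveE// [LHS](diff_compE _ (ex_diff (is_diff_def := l)) dg).
by rewrite (is_diffE _ l) scale1r.
Qed.

(** Mean value theorem applied to s |-> f (x + s v + h w) - f (x + s v), and then
    to the derivative in direction [v], along [w]. *)
Lemma second_difference V (U : set V) (f : V -> R) (x v w : V) (h : R) :
  Ck 2 U f -> 0 < h ->
  (forall s t, 0 <= s <= h -> 0 <= t <= h -> U (x + s *: v + t *: w)) ->
  exists s t, [/\ 0 <= s <= h, 0 <= t <= h &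
    (f (x + h *: v + h *: w) - f (x + h *: v)) - (f (x + h *: w) - f x) =
    'd (fun y => 'd f y v) (x + s *: v + t *: w) w * h * h].
Proof.
move=> [df /(_ v)[ddf _]] h0 Uxh.
have hh : 0 <= h <= h by apply/andP; split => //; exact: ltW.
have h00 : 0 <= (0 : R) <= h by rewrite lexx ltW.
pose k s := f (x + h *: w + s *: v) - f (x + s *: v).
pose dk s := 'd f (x + h *: w + s *: v) v - 'd f (x + s *: v) v.
have kE s : s \in `[0, h] -> is_derive s (1 : R) k (dk s).
  move=> /[!in_itv]/= sh; apply: is_deriveB; apply: is_derive_line; apply: df.
    by rewrite addrAC; exact: Uxh.
  by have := Uxh s 0 sh h00; rewrite scale0r addr0.
have [s sh kh] : exists2 s, s \in `[0, h]%R & k h - k 0 = dk s * (h - 0).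
  have kE' s (sh : s \in `]0, h[) := kE s (subset_itv_oo_cc sh).
  refine (MVT_segment (ltW h0) kE' _).
  by apply: derivable_within_continuous => s /kE[].
have sh' : 0 <= s <= h by move: sh; rewrite in_itv.
pose l t := 'd f (x + s *: v + t *: w) v.
have lE t : t \in `[0, h] ->
    is_derive t (1 : R) l ('d (fun y => 'd f y v) (x + s *: v + t *: w) w).
  move=> /[!in_itv]/= th.
  by apply: (@is_derive_line _ _ (fun y => 'd f y v)); apply: ddf; exact: Uxh.
have [t th lh] : exists2 t, t \in `[0, h]%R &
    l h - l 0 = 'd (fun y => 'd f y v) (x + s *: v + t *: w) w * (h - 0).
  have lE' t (th : t \in `]0, h[) := lE t (subset_itv_oo_cc th).
  refine (MVT_segment (ltW h0) lE' _).
  by apply: derivable_within_continuous => t /lE[].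
have th' : 0 <= t <= h by move: th; rewrite in_itv.
exists s, t; split; [exact: sh'|exact: th'|].
move: kh lh; rewrite /k /dk /l !scale0r !addr0 !subr0 => kh lh.
rewrite [x + h *: v + h *: w]addrAC kh -lh.
by rewrite [x + h *: w + _]addrAC.
Qed.

(** Symmetry of second derivatives (Schwarz): by [second_difference] the two
    mixed derivatives, at suitable points close to [x], are the same second
    difference quotient. *)
Lemma diff_sym_scalar V (U : set V) (f : V -> R) (x v w : V) :
  open U -> Ck 2 U f -> U x ->
  'd (fun y => 'd f y v) x w = 'd (fun y => 'd f y w) x v.
Proof.
move=> oU ck Ux.
apply/eqP; rewrite -subr_eq0 -normr_le0; apply/ler_addgt0Pl => e e0.
rewrite addr0.
have e20 : 0 < e / 2 by rewrite divr_gt0.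
have [[_ /(_ v)[_ /(_ w) cv]] [_ /(_ w)[_ /(_ v) cw]]] := (ck, ck).
have /cvgrPdist_lt /(_ _ e20) nv := cv x Ux.
have /cvgrPdist_lt /(_ _ e20) nw := cw x Ux.
have nU : \forall y \near x, U y by exact: open_nbhs_nbhs.
have [r /= r0 hr] : exists2 r : R, 0 < r & forall y, `|x - y| < r ->
  [/\ U y, `|'d (fun y => 'd f y v) x w - 'd (fun y => 'd f y v) y w| < e / 2
    & `|'d (fun y => 'd f y w) x v - 'd (fun y => 'd f y w) y v| < e / 2].
  have /nbhs_ballP[r r0 hr] : nbhs x [set y | [/\ U y,
      `|'d (fun y => 'd f y v) x w - 'd (fun y => 'd f y v) y w| < e / 2 &
      `|'d (fun y => 'd f y w) x v - 'd (fun y => 'd f y w) y v| < e / 2]].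
    by near=> y; split; near: y; [exact: nU|exact: nv|exact: nw].
  by exists r => // y xy; apply: hr; rewrite -ball_normE.
(* The points where the second derivatives are evaluated are within
   h (|v| + |w|) < r of x. *)
pose h := r / (`|v| + `|w| + 1).
have D0 : 0 < `|v| + `|w| + 1 by rewrite ltr_wpDl// addr_ge0.
have h0 : 0 < h by rewrite divr_gt0.
have close s t : 0 <= s <= h -> 0 <= t <= h -> forall v' w',
    `|v'| + `|w'| = `|v| + `|w| -> `|x - (x + s *: v' + t *: w')| < r.
  move=> /andP[s0 sh] /andP[t0 th] v' w' vw.
  rewrite -addrA opprD addrA subrr add0r normrN.
  apply: (@le_lt_trans _ _ (h * (`|v| + `|w|))).
    rewrite (le_trans (ler_normD _ _))// !normrZ !ger0_norm// -vw mulrDr.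
    by rewrite lerD// ler_wpM2r.
  by rewrite /h mulrAC ltr_pdivrMr// ltr_pM2l// ltrDl.
have [s [t [sh th]]] := second_difference ck h0
  (fun s t sh th => let: And3 u _ _ := hr _ (close s t sh th v w erefl) in u).
have [s' [t' [sh' th']]] := second_difference ck h0
  (fun s t sh th =>
    let: And3 u _ _ := hr _ (close s t sh th w v (addrC _ _)) in u).
(* The second difference is symmetric in v and w. *)
have -> : f (x + h *: w + h *: v) - f (x + h *: w) - (f (x + h *: v) - f x) =
  f (x + h *: v + h *: w) - f (x + h *: v) - (f (x + h *: w) - f x).
  have swap (a b c d : R) : a - b - (c - d) = a - c - (b - d).
    by rewrite !opprB addrACA [RHS]addrACA [- b - c]addrC.
  by rewrite swap [x + h *: w + _]addrAC.
move=> -> E.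
have {}E : 'd (fun y => 'd f y v) (x + s *: v + t *: w) w =
           'd (fun y => 'd f y w) (x + s' *: w + t' *: v) v.
  by move: E => /mulIf/=; rewrite gt_eqF// => /(_ isT)/mulIf; rewrite gt_eqF// => /(_ isT).
have [_ n1 _] := hr _ (close s t sh th v w erefl).
have [_ _ n2] := hr _ (close s' t' sh' th' w v (addrC _ _)).
apply: ltW; rewrite (splitr e).
move: n1; rewrite E => n1.
rewrite distrC in n2.
by apply: le_lt_trans (ltrD n1 n2); rewrite (le_trans _ (ler_normD _ _))// subrKA.
Unshelve. all: by end_near. Qed.

Lemma diff_sym V n (U : set V) (f : V -> 'rV[R]_n) (x v w : V) :
  open U -> Ck 2 U f -> U x ->
  'd (fun y => 'd f y v) x w = 'd (fun y => 'd f y w) x v.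
Proof.
move=> oU ck Ux; apply/rowP => j.
pose c (M : 'rV[R]_n) := M 0 j.
have hc y : is_diff y c c by exact: is_diff_coord.
have [df cdf] := ck.
have E v' w' : 'd (fun y => 'd (c \o f) y v') x w' =
               'd (fun y => 'd f y v') x w' 0 j.
  have [ddf _] := cdf v'.
  have cE y M : 'd c y M = M 0 j by exact: is_diffE.
  rewrite -(cE ('d f x v')).
  rewrite -[RHS](diff_compE (f := fun y => 'd f y v')); [|exact: ddf|exact: ex_diff].
  have near_E : \forall y \near x, c ('d f y v') = 'd (c \o f) y v'.
    apply: (open_near oU Ux) => y Uy.
    rewrite [RHS]diff_compE; [|exact: df|exact: ex_diff].
    by rewrite cE.
  rewrite -(near_eq_diff near_E)//.
  by apply: differentiable_comp; [exact: ddf|exact: ex_diff].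
by rewrite -!E; apply: diff_sym_scalar Ux => //; exact: Ck_comp_linear.
Qed.
End Symmetry.

(** * Atlases, charts and the chain rule on manifolds *)

Section Atlas.
Context {R : realType}.

(** What remains of [is_manifold] without separation and countability: it passes
    to products at once, holds for vector spaces, and is all that the chain rule
    uses. *)
Definition smooth_atlas (V : normedModType R) (M : charted V) : Prop :=
  [/\ forall x : M, is_chart (chart_dom M x) (chart_map M x) (chart_inv M x),
      forall x : M, chart_dom M x x &
      forall x y : M,
        smooth_on (chart_map M x @` (chart_dom M x `&` chart_dom M y))
                  (chart_map M y \o chart_inv M x)].

Lemma manifold_atlas (V : normedModType R) (M : charted V) :
  is_manifold M -> smooth_atlas M.
Proof. by case. Qed.

Definition chart_expr (V W : normedModType R) (M : charted V) (N : charted W)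
    (f : M -> N) (a : M) (b : N) : V -> W :=
  chart_map N b \o f \o chart_inv M a.

Section OneChart.
Variables (V : normedModType R) (M : charted V).
Hypothesis hM : smooth_atlas M.

Lemma chart_mapK (a y : M) : chart_dom M a y ->
  chart_inv M a (chart_map M a y) = y.
Proof. by case: hM => /(_ a)[_ _ K _ _] _ _; exact: K. Qed.

Lemma chart_open_image (a : M) (A : set M) :
  open A -> open (chart_map M a @` (chart_dom M a `&` A)).
Proof.
move=> oA; case: hM => /(_ a)[oD oI K cphi cpsi] _ _.
have -> : chart_map M a @` (chart_dom M a `&` A) =
    (chart_map M a @` chart_dom M a) `&` chart_inv M a @^-1` A.
  apply/seteqP; split=> u.
    by case=> y [Dy Ay] <-; split; [exists y|rewrite /preimage /= K].
  by case=> -[y Dy <-]; rewrite /preimage /= K// => Ay; exists y.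
rewrite openE => u [Iu Au]; apply: filterI.
  exact: open_nbhs_nbhs.
by apply: cpsi => //; exact: open_nbhs_nbhs.
Qed.

Lemma near_chart_inv (a y : M) (P : M -> Prop) : chart_dom M a y ->
  (\forall z \near y, P z) ->
  \forall u \near chart_map M a y, P (chart_inv M a u).
Proof.
move=> Dy nP; case: hM => /(_ a)[oD oI K cphi cpsi] _ _.
have /= := cpsi (chart_map M a y); rewrite /prop_for /continuous_at K//.
by apply => //; exists y.
Qed.

Lemma near_chart_invK (a y : M) : chart_dom M a y ->
  \forall u \near chart_map M a y, chart_map M a (chart_inv M a u) = u.
Proof.
move=> Dy; case: hM => /(_ a)[oD oI K cphi cpsi] _ _.
apply: (open_near oI) => [|u [z Dz <-]]; first by exists y.
by rewrite K.
Qed.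

Lemma near_chart_dom (a y : M) : chart_dom M a y ->
  \forall z \near y, chart_dom M a z.
Proof.
by move=> Dy; case: hM => /(_ a)[oD oI K cphi cpsi] _ _; exact: open_nbhs_nbhs.
Qed.

Lemma smooth_id : smooth_map (M := M) (N := M) id.
Proof. by split=> [x|]; [exact: cvg_id|case: hM]. Qed.
End OneChart.

Section Expr.
Variables (V W : normedModType R) (M : charted V) (N : charted W).
Hypotheses (hM : smooth_atlas M) (hN : smooth_atlas N).

Lemma chart_expr_open (f : M -> N) (a : M) (b : N) : continuous f ->
  open (chart_map M a @` (chart_dom M a `&` f @^-1` chart_dom N b)).
Proof.
move=> cf; apply: chart_open_image => //; apply: open_comp => // .
by case: hN => /(_ b)[].
Qed.

Lemma smooth_differentiable (f : M -> N) (a x : M) (b : N) :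
  smooth_map f -> chart_dom M a x -> chart_dom N b (f x) ->
  differentiable (chart_expr f a b) (chart_map M a x).
Proof. by move=> [_ /(_ a b 1)[df _]] Dx Dfx; apply: df; exists x. Qed.

(** Continuity is required because differentiability of the chart expression does
    not provide it: [chart_map] has arbitrary values outside the domain of the
    chart, which [f] could leave arbitrarily close to [x]. *)
Definition mdifferentiable (f : M -> N) (x : M) : Prop :=
  {for x, continuous f} /\
  differentiable (chart_expr f x (f x)) (chart_map M x x).

Lemma smooth_mdifferentiable (f : M -> N) (x : M) :
  smooth_map f -> mdifferentiable f x.
Proof.
move=> sf; split; first by case: sf => + _; apply.
by apply: smooth_differentiable => //; [case: hM|case: hN].
Qed.
End Expr.

Section Comp.
Variables (V W X : normedModType R).
Variables (M : charted V) (N : charted W) (P : charted X).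
Hypotheses (hM : smooth_atlas M) (hN : smooth_atlas N).

(** The chain rule, in arbitrary charts.  The chart expression of the composite is
    the composite of the chart expressions only near the point, where [f] stays
    in the domain of the intermediate chart. *)
Lemma chart_expr_comp (f : M -> N) (g : N -> P) (a x : M) (b : N) (c : P) :
  {for x, continuous f} -> chart_dom M a x -> chart_dom N b (f x) ->
  differentiable (chart_expr f a b) (chart_map M a x) ->
  differentiable (chart_expr g b c) (chart_map N b (f x)) ->
  is_diff (chart_map M a x) (chart_expr (g \o f) a c)
    (fun v => 'd (chart_expr g b c) (chart_map N b (f x))
              ('d (chart_expr f a b) (chart_map M a x) v)).
Proof.
move=> cf Dx Dfx df dg.
have E : chart_expr f a b (chart_map M a x) = chart_map N b (f x).
  by rewrite /chart_expr /= chart_mapK.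
rewrite -E in dg *.
apply: (@near_eq_is_diff _ _ _ (chart_expr g b c \o chart_expr f a b)); last first.
  apply: DiffDef; first exact: differentiable_comp.
  by apply/funext => v; rewrite diff_compE.
have nfx : \forall y \near x, chart_dom N b (f y).
  exact: cf _ (near_chart_dom hN Dfx).
suff nQ : \forall y \near x,
    chart_expr g b c (chart_map N b (f y)) = chart_map P c (g (f y)).
  exact: (near_chart_inv hM Dx nQ).
near=> y; rewrite /chart_expr /= chart_mapK//; near: y; exact: nfx.
Unshelve. all: by end_near. Qed.

Lemma mdifferentiable_comp (f : M -> N) (g : N -> P) (x : M) :
  mdifferentiable f x -> mdifferentiable g (f x) -> mdifferentiable (g \o f) x.
Proof.
move=> [cf df] [cg dg]; split; first exact: continuous_comp.
have [[_ dM _] [_ dN _]] := (hM, hN).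
by have [] := chart_expr_comp cf (dM x) (dN (f x)) df dg.
Qed.

Lemma mdiff_comp (f : M -> N) (g : N -> P) (x : M) v :
  mdifferentiable f x -> mdifferentiable g (f x) ->
  mdiff (g \o f) x v = mdiff g (f x) (mdiff f x v).
Proof.
move=> [cf df] [cg dg]; have [[_ dM _] [_ dN _]] := (hM, hN).
exact: is_diffE (chart_expr_comp cf (dM x) (dN (f x)) df dg).
Qed.
End Comp.

Lemma mdiff_id (V : normedModType R) (M : charted V) (x : M) v :
  smooth_atlas M -> mdiff (M := M) (N := M) id x v = v.
Proof.
move=> hM; apply: (@is_diffE _ _ _ _ id); apply: (near_eq_is_diff (f := id)).
by case: (hM) => _ + _ => /(_ x) /(near_chart_invK hM); apply: filterS => u /= ->.
Qed.

Lemma vect_atlas (V : normedModType R) : smooth_atlas (vect_charted V).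
Proof.
split=> //= [x|x y k].
  split=> //=; [exact: openT|by rewrite image_id; exact: openT| |];
    by move=> u _; exact: cvg_id.
have idd (u : V) : is_diff u (id : V -> V) id by exact: is_diff_id.
exact: (Ck_affine _ _ idd).
Qed.

Lemma continuous_pair (S T1 T2 : topologicalType) (f : S -> T1) (g : S -> T2) x :
  {for x, continuous f} -> {for x, continuous g} ->
  {for x, continuous (fun y => (f y, g y))}.
Proof. by move=> cf cg; apply: cvg_pair; [exact: cf|exact: cg]. Qed.

Lemma open_prod (T1 T2 : topologicalType) (A : set T1) (B : set T2) :
  open A -> open B -> open (A `*` B).
Proof.
move=> oA oB; have -> : A `*` B = fst @^-1` A `&` snd @^-1` B by [].
by apply: openI; apply: open_comp => // u _; [exact: cvg_fst|exact: cvg_snd].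
Qed.

Section Product.
Variables (V W : normedModType R) (M : charted V) (N : charted W).
Hypotheses (hM : smooth_atlas M) (hN : smooth_atlas N).

(** A map acting separately on the two factors consists of two maps precomposed
    with the linear projections. *)
Lemma smooth_on_prod (V1 W1 V2 W2 : normedModType R) (U1 : set V1) (U2 : set V2)
    (U : set (V1 * V2)) (f1 : V1 -> W1) (f2 : V2 -> W2) :
  open U1 -> open U2 -> U `<=` U1 `*` U2 ->
  smooth_on U1 f1 -> smooth_on U2 f2 ->
  smooth_on U (fun u => (f1 u.1, f2 u.2)).
Proof.
move=> o1 o2 sU s1 s2 k; apply: Ck_sub sU _.
apply: Ck_pair; first exact: open_prod.
- apply: (@Ck_sub _ _ _ _ (fst @^-1` U1)) => [u []//|].
  by apply: (Ck_comp_affine (f := f1)) => // u; exact: is_diff_fst.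
- apply: (@Ck_sub _ _ _ _ (snd @^-1` U2)) => [u []//|].
  by apply: (Ck_comp_affine (f := f2)) => // u; exact: is_diff_snd.
Qed.

Lemma prod_atlas : smooth_atlas (prod_charted M N).
Proof.
case: (hM) (hN) => cM dM sM [cN dN sN]; split=> [x|x|x y].
- have [oM iM KM fM gM] := cM x.1; have [oN iN KN fN gN] := cN x.2.
  have -> : is_chart (chart_dom (prod_charted M N) x) (chart_map _ x) (chart_inv _ x) =
    is_chart (chart_dom M x.1 `*` chart_dom N x.2)
      (fun y => (chart_map M x.1 y.1, chart_map N x.2 y.2))
      (fun u => (chart_inv M x.1 u.1, chart_inv N x.2 u.2)) by [].
  have E : (fun y => (chart_map M x.1 y.1, chart_map N x.2 y.2)) @`
      (chart_dom M x.1 `*` chart_dom N x.2) =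
      (chart_map M x.1 @` chart_dom M x.1) `*` (chart_map N x.2 @` chart_dom N x.2).
    apply/seteqP; split => u.
      by case=> y [y1 y2] <-; split; [exists y.1|exists y.2].
    by case: u => u1 u2 [[y1 D1 /= <-] [y2 D2 /= <-]]; exists (y1, y2).
  split.
  + exact: open_prod.
  + by rewrite E; exact: open_prod.
  + by case=> y1 y2 [/= D1 D2]; rewrite KM// KN.
  + move=> y [D1 D2]; apply: cvg_pair.
      by apply: continuous_comp; [exact: cvg_fst|exact: fM].
    by apply: continuous_comp; [exact: cvg_snd|exact: fN].
  + rewrite E => u [D1 D2]; apply: cvg_pair.
      by apply: continuous_comp; [exact: cvg_fst|exact: gM].
    by apply: continuous_comp; [exact: cvg_snd|exact: gN].
- by split=> /=; [exact: dM|exact: dN].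
- have o1 := chart_open_image hM x.1 (let: And5 o _ _ _ _ := cM y.1 in o).
  have o2 := chart_open_image hN x.2 (let: And5 o _ _ _ _ := cN y.2 in o).
  apply: (smooth_on_prod o1 o2) (sM x.1 y.1) (sN x.2 y.2).
  by move=> u [z [[/= D1 D2] [/= D1' D2']] <-]; split; [exists z.1|exists z.2].
Qed.

Variables (X : normedModType R) (P : charted X).
Hypothesis hP : smooth_atlas P.

(** In charts, freezing a variable is precomposition with an affine embedding.
    The chart around [c] is the preferred one, so that [c] itself corresponds to
    a point of the model space. *)
Lemma smooth_mapl (f : prod_charted M N -> P) (c : N) :
  smooth_map f -> smooth_map (M := M) (fun x => f (x, c)).
Proof.
move=> sf; have [cf sf'] := sf; split=> [x|a b k].
  by apply: continuous_comp (cf _); apply: cvg_pair => //; exact: cvg_cst.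
have Dc : chart_dom N c c by case: hN.
have o := chart_expr_open prod_atlas hP (a, c) b cf.
have H := Ck_comp_affine o (is_diff_inl (chart_map N c c)) (sf' (a, c) b k).
have {H} := Ck_sub _ H.
have -> : chart_map P b \o f \o chart_inv (prod_charted M N) (a, c) \o
    (fun u => (u, chart_map N c c)) =
    chart_map P b \o (fun x => f (x, c)) \o chart_inv M a.
  by apply/funext => u /=; rewrite (chart_mapK hN).
apply => u [x [Dx Dfx] <-]; exists (x, c) => //; split => //; split => //=.
Qed.

Lemma smooth_mapr (f : prod_charted M N -> P) (c : M) :
  smooth_map f -> smooth_map (M := N) (fun x => f (c, x)).
Proof.
move=> sf; have [cf sf'] := sf; split=> [x|a b k].
  by apply: continuous_comp (cf _); apply: cvg_pair => //; exact: cvg_cst.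
have Dc : chart_dom M c c by case: hM.
have o := chart_expr_open prod_atlas hP (c, a) b cf.
have H := Ck_comp_affine o (is_diff_inr (chart_map M c c)) (sf' (c, a) b k).
have {H} := Ck_sub _ H.
have -> : chart_map P b \o f \o chart_inv (prod_charted M N) (c, a) \o
    (fun u => (chart_map M c c, u)) =
    chart_map P b \o (fun x => f (c, x)) \o chart_inv N a.
  by apply/funext => u /=; rewrite (chart_mapK hM).
apply => u [x [Dx Dfx] <-]; exists (c, x) => //; split => //; split => //=.
Qed.
End Product.
End Atlas.

(** * Linear forms on row vectors *)

Lemma pairingE (R : realType) (n : nat) (a : 'cV[R]_n) (v : 'rV[R]_n) :
  pairing a v = \sum_j v 0 j * a j 0.
Proof. by rewrite /pairing mxE. Qed.

Lemma is_diff_pairing (R : realType) (n : nat) (a : 'cV[R]_n) (x : 'rV[R]_n) :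
  is_diff x (pairing a : 'rV[R]_n -> R) (pairing a).
Proof.
have -> : pairing a = fun v => \sum_j v 0 j * a j 0.
  by apply/funext => v; exact: pairingE.
apply: is_diff_sum => j.
have hM := is_diffM (is_diff_coord x 0 j) (is_diff_cst (a j 0) x).
apply: is_diff_eq hM _; apply/funext => v.
by rewrite !fctE scaler0 add0r mulrC.
Qed.

Lemma pairing_is_linear (R : realType) (n : nat) (a : 'cV[R]_n) :
  linear (pairing a : 'rV[R]_n -> R).
Proof. by move=> k u v; rewrite /pairing mulmxDl -scalemxAl !mxE. Qed.
HB.instance Definition _ (R : realType) (n : nat) (a : 'cV[R]_n) :=
  GRing.isLinear.Build R 'rV[R]_n R _ (pairing a) (pairing_is_linear a).

Lemma pairing0l (R : realType) (n : nat) (v : 'rV[R]_n) : pairing 0 v = 0.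
Proof. by rewrite /pairing mulmx0 mxE. Qed.

Lemma pairing_delta (R : realType) (n : nat) (a : 'cV[R]_n) j :
  pairing a (delta_mx 0 j) = a j 0.
Proof.
rewrite pairingE (bigD1 j)//= mxE !eqxx mul1r big1 ?addr0// => k kj.
by rewrite mxE (negPf kj) andbF mul0r.
Qed.

Lemma pairing_inj (R : realType) (n : nat) (a b : 'cV[R]_n) :
  (forall v, pairing a v = pairing b v) -> a = b.
Proof. by move=> ab; apply/colP => j; rewrite -!pairing_delta. Qed.

Lemma pairing_eq0 (R : realType) (n : nat) (a : 'cV[R]_n) :
  (forall v, pairing a v = 0) -> a = 0.
Proof.
move=> a0; apply/colP => j.
by rewrite -pairing_delta a0 mxE.
Qed.

(** [form_col] only records values on the canonical basis, so linearity of [f] is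
    essential. *)
Lemma pairing_form_col (R : realType) (n : nat) (f : {linear 'rV[R]_n -> R}) v :
  pairing (form_col f) v = f v.
Proof.
rewrite pairingE [in RHS](row_sum_delta v) linear_sum.
by apply: eq_bigr => k _; rewrite linearZ mxE.
Qed.

Lemma is_diff_pairingl (R : realType) (n : nat) (v : 'rV[R]_n) (a : 'cV[R]_n) :
  is_diff a (fun b : 'cV[R]_n => pairing b v : R) (fun b => pairing b v).
Proof.
have -> : (fun b : 'cV[R]_n => pairing b v : R) = fun b => \sum_j v 0 j * b j 0.
  by apply/funext => b; exact: pairingE.
apply: is_diff_sum => j.
have hM := is_diffM (is_diff_cst (v 0 j) a) (is_diff_coord a j 0).
apply: is_diff_eq hM _; apply/funext => b.
by rewrite !fctE scaler0 addr0.
Qed.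

Lemma injective_linear_leq (R : realType) (m n : nat) (f : 'rV[R]_m -> 'rV[R]_n) :
  linear f -> injective f -> (m <= n)%N.
Proof.
move=> lf fI.
pose fM := GRing.isLinear.Build _ _ _ _ _ lf.
pose F : {linear 'rV[R]_m -> 'rV[R]_n} := HB.pack f fM.
have : row_free (lin1_mx F).
  apply: inj_row_free => v; rewrite mul_rV_lin1 => Fv0.
  by apply: fI; rewrite [LHS]Fv0; apply/esym; exact: (linear0 F).
by rewrite /row_free => /eqP <-; exact: rank_leq_col.
Qed.

(** * Linear forms on a semisimple Lie algebra *)

(** In a simple ideal I the elements killed by [a] form an ideal J of I, all
    brackets being killed; J = 0 is excluded because I is not abelian. *)
Lemma semisimple_perfect (R : realType) (n : nat)
    (br : 'rV[R]_n -> 'rV[R]_n -> 'rV[R]_n) (a : 'cV[R]_n) :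
  semisimple_bracket br -> (forall x y, pairing a (br x y) = 0) -> a = 0.
Proof.
move=> [m [I [idI simI _ sumI]]] abr.
pose f : 'Hom('rV[R]_n, R^o) := linfun (pairing a).
have fE v : f v = pairing a v by rewrite lfunE.
have aI i v : v \in I i -> pairing a v = 0.
  have [[x [y [Ix Iy xy0]]] idl] := simI i.
  have brI u w : w \in I i -> br u w \in (I i :&: lker f)%VS.
    by move=> Iw; rewrite memv_cap memv_ker fE abr eqxx andbT; exact: idI.
  have [||E] := idl (I i :&: lker f)%VS (capvSl _ _).
  - by move=> u w _; rewrite memv_cap => /andP[Iw _]; exact: brI.
  - by move=> E; have := brI x y Iy; rewrite E memv0 (negPf xy0).
  - by rewrite -E memv_cap memv_ker fE => /andP[_ /eqP].
apply: pairing_eq0 => v.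
have /memv_sumP[w Iw ->] : v \in (\sum_i I i)%VS by rewrite sumI memvf.
by rewrite linear_sum big1// => i _; exact: aI (Iw i isT).
Qed.

(** * Lie groups *)

Section LieGroup.
Variables (R : realType) (n : nat) (G : lieGroup R n).
Local Notation V := 'rV[R]_n.
Local Notation e := (lie_one G).
Local Notation "x ** y" := (lie_mul G x y) (at level 40, left associativity).
Local Notation inv := (lie_inv G).

Lemma lie_invP (a b : G) : a ** b = e -> b = inv a.
Proof. by move=> ab; rewrite -[LHS]lie_mul1 -(lie_mulV a) -lie_mulA ab lie_mulr1. Qed.

Lemma lie_inv1 : inv e = e.
Proof. by apply/esym/lie_invP; rewrite lie_mul1. Qed.

Lemma lie_invK (a : G) : inv (inv a) = a.
Proof. by apply/esym/lie_invP; rewrite lie_mulV. Qed.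

Lemma lie_invM (a b : G) : inv (a ** b) = inv b ** inv a.
Proof.
apply/esym/lie_invP.
by rewrite lie_mulA -[a ** b ** _]lie_mulA lie_mulrV lie_mulr1 lie_mulrV.
Qed.

Lemma lie_atlas : smooth_atlas G.
Proof. exact: manifold_atlas (lie_manifold G). Qed.
Local Notation hG := lie_atlas.

Lemma lie_dom (x : G) : chart_dom G x x.
Proof. by have [_ d _] := hG. Qed.

Lemma smooth_lmul (g : G) : smooth_map (lie_mul G g).
Proof. by have := smooth_mapr hG hG hG g (lie_smooth_mul G). Qed.

Lemma smooth_rmul (g : G) : smooth_map (fun x : G => x ** g).
Proof. by have := smooth_mapl hG hG hG g (lie_smooth_mul G). Qed.

(** ** Multiplication in the chart at the identity *)

Let phi := chart_map G e.
Let psi := chart_inv G e.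
Let o : V := phi e.

Let mul2 (p : prod_charted G G) : G := p.1 ** p.2.

Definition chart_mul : V * V -> V :=
  chart_expr (M := prod_charted G G) mul2 (e, e) e.
Local Notation m := chart_mul.

Let U : set (V * V) := chart_map (prod_charted G G) (e, e) @`
  (chart_dom (prod_charted G G) (e, e) `&` mul2 @^-1` chart_dom G e).

Let oU : open U.
Proof.
apply: (chart_expr_open (prod_atlas hG hG) hG).
by have [] := lie_smooth_mul G.
Qed.

Let ckm k : Ck k U m.
Proof. by have [_ /(_ (e, e) e k)] := lie_smooth_mul G. Qed.

Let Uoo : U (o, o).
Proof.
exists (e, e) => //; split; first by split; exact: lie_dom.
by rewrite /preimage /mul2 /= lie_mul1; exact: lie_dom.
Qed.

Let nearU : \forall p \near (o, o), U p.
Proof. exact: open_nbhs_nbhs. Qed.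

Let dm p : U p -> differentiable m p.
Proof. by case: (ckm 1) => + _; exact. Qed.

Let ddm a p : U p -> differentiable (fun q => 'd m q a) p.
Proof. by case: (ckm 2) => _ /(_ a)[+ _]; exact. Qed.

Let psio : psi o = e. Proof. exact: chart_mapK hG _ _ (lie_dom e). Qed.

Let near_psiK : \forall u \near o, phi (psi u) = u.
Proof. exact: near_chart_invK hG _ _ (lie_dom e). Qed.

Let near_psi_dom : \forall u \near o, chart_dom G e (psi u).
Proof.
exact: (near_chart_inv hG (lie_dom e) (P := chart_dom G e)
  (near_chart_dom hG (lie_dom e))).
Qed.

Let nearUl : \forall u \near o, U (u, o).
Proof.
have l := is_diff_inl o o.
by have := differentiable_continuous (ex_diff (is_diff_def := l)) nearU.
Qed.

Let mul_o : \forall u \near o, m (u, o) = u.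
Proof.
apply: filterS near_psiK => u uK.
by rewrite /m /chart_expr /mul2 /= -/phi -/psi -/o psio lie_mulr1 uK.
Qed.

Let o_mul : \forall u \near o, m (o, u) = u.
Proof.
apply: filterS near_psiK => u uK.
by rewrite /m /chart_expr /mul2 /= -/phi -/psi -/o psio lie_mul1 uK.
Qed.

Let dm_inl (u c Y : V) : U (u, c) ->
  'd (fun x => m (x, c)) u Y = 'd m (u, c) (Y, 0).
Proof.
move=> Uuc; have l := is_diff_inl c u.
rewrite [LHS](diff_compE (f := fun x => (x, c)) (g := m)).
- by rewrite (is_diffE _ l).
- exact: (ex_diff (is_diff_def := l)).
- exact: dm.
Qed.

Let dm_inr (u c Y : V) : U (c, u) ->
  'd (fun x => m (c, x)) u Y = 'd m (c, u) (0, Y).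
Proof.
move=> Ucu; have l := is_diff_inr c u.
rewrite [LHS](diff_compE (f := fun x => (c, x)) (g := m)).
- by rewrite (is_diffE _ l).
- exact: (ex_diff (is_diff_def := l)).
- exact: dm.
Qed.

(** x 1 = x holds near 1, so it can be differentiated at all points x near 1, and
   then once more, as in [hess_ll]. *)
Let near_dmul_o Y : \forall u \near o, 'd m (u, o) (Y, 0) = Y.
Proof.
near=> u.
have Uu : U (u, o) by near: u; exact: nearUl.
rewrite -dm_inl//; apply: (@is_diffE _ _ _ _ id).
apply: (near_eq_is_diff (f := id)).
by apply: filterS (_ : \forall v \near u, m (v, o) = v) => [v ->//|];
  near: u; exact: (near_join mul_o).
Unshelve. all: by end_near. Qed.

Let dmul_oo a b : 'd m (o, o) (a, b) = a + b.
Proof.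
have -> : (a, b) = (a, 0) + (0, b) :> V * V by congr pair; rewrite ?addr0 ?add0r.
rewrite linearD; congr (_ + _); first exact: nbhs_singleton (near_dmul_o a).
rewrite -dm_inr//; apply: (@is_diffE _ _ _ _ id).
by apply: (near_eq_is_diff (f := id)); apply: filterS o_mul => v ->.
Qed.

(** The direction [a] of the inner derivative comes first, that of the outer
    derivative second. *)
Definition mul_hess (a b : V * V) : V := 'd (fun p => 'd m p a) (o, o) b.
Local Notation H := mul_hess.

Let hess_sym a b : H a b = H b a.
Proof. exact: diff_sym oU (ckm 2) Uoo. Qed.

Let hessB a b c : H a (b - c) = H a b - H a c.
Proof. exact: linearB. Qed.

Let hess_sum a (c : 'I_n -> R) (s : 'I_n -> V * V) :
  H a (\sum_k c k *: s k) = \sum_k c k *: H a (s k).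
Proof. exact: linear_comb. Qed.

Let is_diff_dmul_o a :
  is_diff o (fun u => 'd m (u, o) a) (fun X => H a (X, 0)).
Proof.
have l := is_diff_inl o o.
have d := differentiableP (ddm a Uoo).
exact: (is_diff_comp (f := fun u => (u, o)) (g := fun p => 'd m p a) l d).
Qed.

Let hess_ll Y X : H (Y, 0) (X, 0) = 0.
Proof.
rewrite -(is_diffE X (is_diff_dmul_o (Y, 0))).
apply: (@is_diffE _ _ _ _ (0 : V -> V)).
apply: (near_eq_is_diff (f := cst Y)).
by apply: filterS (near_dmul_o Y) => u ->.
Qed.

Let expr_lmul u : chart_expr (lie_mul G (psi u)) e e = fun y => m (u, y).
Proof. by []. Qed.

(** [field_in_chart] transports the vector from the preferred chart at the point
    back to the chart at the identity; by the chain rule the intermediate chart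
    drops out. *)
Lemma near_left_invariant X : \forall u \near o,
  field_in_chart (left_invariant (G := G) X) e u = 'd m (u, o) (0, X).
Proof.
near=> u.
have Dq : chart_dom G e (psi u) by near: u; exact: near_psi_dom.
have Uu : U (u, o) by near: u; exact: nearUl.
have uK : phi (psi u) = u by near: u; exact: near_psiK.
have sl := smooth_lmul (psi u).
rewrite -dm_inr// -expr_lmul.
have q1 : psi u ** e = psi u by rewrite lie_mulr1.
rewrite /field_in_chart -/psi /left_invariant /mdiff q1.
apply/esym.
have [cf _] := sl.
have D : chart_dom G (psi u) (psi u ** e) by rewrite q1; exact: lie_dom.
have d1 := smooth_differentiable sl (lie_dom e) D.
have d2 := smooth_differentiable (smooth_id hG) D
  (eq_ind_r (chart_dom G e) Dq q1).
have := chart_expr_comp hG hG (cf e) (lie_dom e) D d1 d2.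
by move/(is_diffE X); rewrite q1.
Unshelve. all: by end_near. Qed.

(** In coordinates centred at the identity the multiplication is
    x + y + b(x, y) + ..., where b is the mixed part of the Hessian.  The
    left-invariant field of X is X + b(x, X) + ..., so the bracket is the
    antisymmetrization of b. *)
Lemma lie_bracketE X Y :
  lie_bracket G X Y = H (0, Y) (X, 0) - H (0, X) (Y, 0).
Proof.
rewrite /lie_bracket /field_bracket -/phi -/o.
have E Z : field_in_chart (left_invariant (G := G) Z) e o = Z.
  by rewrite (nbhs_singleton (near_left_invariant Z)) dmul_oo add0r.
rewrite !E.
have D Z X' : 'd (field_in_chart (left_invariant (G := G) Z) e) o X' =
    H (0, Z) (X', 0).
  have nE : \forall u \near o, 'd m (u, o) (0, Z) =
      field_in_chart (left_invariant (G := G) Z) e u.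
    by apply: filterS (near_left_invariant Z) => u /esym.
  have d0 := is_diff_dmul_o (0, Z).
  have d : is_diff o (field_in_chart (left_invariant (G := G) Z) e)
    (fun Y => H (0, Z) (Y, 0)).
    exact: (near_eq_is_diff nE d0).
  exact: (is_diffE X' d).
by congr (_ - _); exact: D.
Qed.

Lemma lie_bracket0l Y : lie_bracket G 0 Y = 0.
Proof.
rewrite lie_bracketE (hess_sym (0, 0)).
have z a : H a (0, 0) = 0 by exact: linear0.
by rewrite !z subr0.
Qed.

(** ** The adjoint representation *)

Definition conj_map (g h : G) : G := g ** h ** inv g.

Lemma smooth_mdiffG (f : G -> G) x : smooth_map f -> mdifferentiable f x.
Proof. by move=> sf; have := smooth_mdifferentiable hG hG x sf. Qed.

Lemma mdifferentiable_conj (g x : G) : mdifferentiable (conj_map g) x.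
Proof.
have dl := smooth_mdiffG x (smooth_lmul g).
have dr := smooth_mdiffG (g ** x) (smooth_rmul (inv g)).
by have := mdifferentiable_comp hG hG dl dr.
Qed.

Lemma conj_map1 (g : G) : conj_map g e = e.
Proof. by rewrite /conj_map lie_mulr1 lie_mulrV. Qed.

Lemma AdM (g h : G) X : Ad (g ** h) X = Ad g (Ad h X).
Proof.
rewrite /Ad -/(conj_map g) -/(conj_map h) -/(conj_map (g ** h)).
have -> : conj_map (g ** h) = conj_map g \o conj_map h.
  by apply/funext => x; rewrite /conj_map /= lie_invM !lie_mulA.
by rewrite (mdiff_comp hG hG) ?conj_map1//; exact: mdifferentiable_conj.
Qed.

Lemma Ad1 X : Ad e X = X.
Proof.
rewrite /Ad -/(conj_map e).
have -> : conj_map e = id.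
  by apply/funext => x; rewrite /conj_map /= lie_inv1 lie_mul1 lie_mulr1.
exact: mdiff_id hG.
Qed.

Let i := chart_expr inv e e.

Let io : i o = o. Proof. by rewrite /i /chart_expr /= -/psi psio lie_inv1. Qed.

Let d_i : differentiable i o.
Proof.
apply: (smooth_differentiable (lie_smooth_inv G)); first exact: lie_dom.
by rewrite lie_inv1; exact: lie_dom.
Qed.

Let nearUi : \forall u \near o, U (u, i u).
Proof.
have l := is_diff_pair (is_diff_id o) (differentiableP d_i).
have := differentiable_continuous (ex_diff (is_diff_def := l)).
by rewrite /prop_for /continuous_at io => /(_ _ nearU).
Qed.

Let near_inv_dom : \forall u \near o, chart_dom G e (inv (psi u)).
Proof.
apply: (near_chart_inv hG (lie_dom e) (P := fun x => chart_dom G e (inv x))).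
have [c _] := lie_smooth_inv G.
have := c e; rewrite /continuous_at lie_inv1.
by move=> /(_ _ (near_chart_dom hG (lie_dom e))).
Qed.

(** Differentiate x x^-1 = 1. *)
Let is_diff_i : is_diff o i (fun X => - X).
Proof.
apply: DiffDef => //; apply/funext => X.
have := differentiableP d_i => di.
have dg := is_diff_pair (is_diff_id o) di.
have dmo : differentiable m (o, i o) by rewrite io; exact: dm.
have : 'd (fun u => m (u, i u)) o X = 0.
  apply: (@is_diffE _ _ _ _ (0 : V -> V)).
  apply: (near_eq_is_diff (f := cst o)).
  apply: filterS near_inv_dom => u D.
  rewrite /m /chart_expr /mul2 /i /chart_expr /= -/phi -/psi.
  by rewrite [psi (phi _)](chart_mapK hG D) lie_mulrV.
rewrite [X in X = _ -> _](diff_compE (f := fun u => (u, i u)) (g := m) X)//.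
rewrite (is_diffE X dg) io dmul_oo => /eqP.
by rewrite addrC addr_eq0 => /eqP.
Qed.

(** Conjugation by x is right multiplication by x^-1 after left multiplication by
   x; the intermediate point is x, which stays in the chart at the identity. *)
Let near_Ad Y : \forall u \near o,
  Ad (psi u) Y = 'd m (u, i u) ('d m (u, o) (0, Y), 0).
Proof.
near=> u.
have Dq : chart_dom G e (psi u) by near: u; exact: near_psi_dom.
have Dqi : chart_dom G e (inv (psi u)) by near: u; exact: near_inv_dom.
have Uu : U (u, o) by near: u; exact: nearUl.
have Ui : U (u, i u) by near: u; exact: nearUi.
have uK : phi (psi u) = u by near: u; exact: near_psiK.
rewrite /Ad -/(conj_map _) /mdiff conj_map1.
have [sl sr] := (smooth_lmul (psi u), smooth_rmul (inv (psi u))).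
have q1 : psi u ** e = psi u by rewrite lie_mulr1.
have D : chart_dom G e (psi u ** e) by rewrite q1.
have D' : chart_dom G e (psi u ** e ** inv (psi u)).
  by rewrite q1 lie_mulrV; exact: lie_dom.
have d1 := smooth_differentiable sl (lie_dom e) D.
have d2 := smooth_differentiable sr D D'.
have [cf _] := sl.
have E := is_diffE Y (chart_expr_comp hG hG (cf e) (lie_dom e) D d1 d2).
etransitivity; first exact: E.
rewrite q1 -/phi uK.
have -> : chart_expr (M := G) (N := G) (fun y => y ** inv (psi u)) e e =
    fun y => m (y, i u).
  apply/funext => y; rewrite /m /chart_expr /mul2 /i /chart_expr /= -/phi -/psi.
  by rewrite [psi (phi _)](chart_mapK hG Dqi).
have E2 := dm_inr Y Uu.
exact (eq_trans (congr1 ('d (fun y => m (y, i u)) u) E2)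
                (dm_inl ('d m (u, o) (0, Y)) Ui)).
Unshelve. all: by end_near. Qed.

(** Decomposing on the canonical basis turns the value, at a variable vector, of a
   differential at a variable point into a sum of products of scalar functions,
   to which the product rule applies. *)
Let inl_sum (w : V) :
  (w, 0) = \sum_k w 0 k *: ((delta_mx 0 k : V), 0) :> V * V.
Proof.
have fstS (s : 'I_n -> V * V) : (\sum_k s k).1 = \sum_k (s k).1.
  by apply: (big_morph fst).
have sndS (s : 'I_n -> V * V) : (\sum_k s k).2 = \sum_k (s k).2.
  by apply: (big_morph snd).
rewrite [RHS]surjective_pairing fstS sndS /= -row_sum_delta.
by rewrite big1// => k _; rewrite scaler0.
Qed.

(** The derivative of Ad is ad.  By [near_Ad], Ad (psi u) Y is D1 m (u, u^-1)
    applied to D2 m (u, 1) Y.  Differentiating the inner factor in direction X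
    gives b(X, Y), for b the mixed part of the Hessian of m.  Differentiating the
    outer one, at the point (u, u^-1), which moves in direction (X, -X), gives
    - b(Y, X): the second derivative in the first variable alone vanishes, and
    the mixed one is - b(Y, X) by symmetry of the Hessian. *)
Lemma is_diff_pairing_Ad (a : 'cV[R]_n) (Y : V) :
  is_diff o (fun u => pairing a (Ad (psi u) Y))
            (fun X => pairing a (lie_bracket G X Y)).
Proof.
pose c k (u : V) := 'd m (u, o) (0, Y) 0 k.
have dc k : is_diff o (c k) (fun X => H (0, Y) (X, 0) 0 k).
  have d1 := is_diff_dmul_o (0, Y).
  exact: (is_diff_comp (g := fun v : V => v 0 k) d1 (is_diff_coord _ 0 k)).
pose dl k : V * V := (delta_mx 0 k, 0).
pose f k (u : V) := pairing a ('d m (u, i u) (dl k)).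
have df k : is_diff o (f k) (fun X => pairing a (H (dl k) (X, - X))).
  have l := is_diff_pair (is_diff_id o) is_diff_i.
  have d := differentiableP (ddm (dl k) Uoo).
  have d' : is_diff (o, i o) (fun p => 'd m p (dl k)) (H (dl k)) by rewrite io.
  have dd := is_diff_comp (f := fun u => (u, i u)) (g := fun p => 'd m p (dl k)) l d'.
  exact: (is_diff_comp (g := pairing a) dd (is_diff_pairing a _)).
have nE : \forall u \near o,
    \sum_k c k u * f k u = pairing a (Ad (psi u) Y).
  apply: filterS (near_Ad Y) => u ->.
  rewrite inl_sum linear_comb linear_sum; apply: eq_bigr => k _.
  by rewrite linearZ.
have dS := is_diff_sum (fun k => is_diffM (dc k) (df k)).
apply: is_diff_eq (near_eq_is_diff nE dS) _.
apply/funext => X.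
have -> : lie_bracket G X Y = H (Y, 0) (X, - X) + H (0, Y) (X, 0).
  rewrite lie_bracketE addrC; congr (_ + _).
  have -> : (X, - X) = (X, 0) - (0, X) :> V * V.
    by congr pair; rewrite ?subr0 ?sub0r.
  by rewrite hessB hess_ll sub0r hess_sym.
have E1 : pairing a (H (Y, 0) (X, - X)) =
    \sum_k Y 0 k * pairing a (H (dl k) (X, - X)).
  rewrite hess_sym inl_sum hess_sum linear_sum; apply: eq_bigr => k _.
  by rewrite linearZ hess_sym.
have E2 : pairing a (H (0, Y) (X, 0)) =
    \sum_k H (0, Y) (X, 0) 0 k * pairing a (delta_mx 0 k).
  rewrite [X in pairing a X]row_sum_delta linear_sum.
  by apply: eq_bigr => k _; rewrite linearZ.
have co k : c k o = Y 0 k by rewrite /c dmul_oo add0r.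
have fo k : f k o = pairing a (delta_mx 0 k).
  by rewrite /f io dmul_oo addr0.
have pD u v : pairing a (u + v) = pairing a u + pairing a v by exact: linearD.
rewrite pD E1 E2 -big_split; apply: eq_bigr => k _.
by rewrite !fctE co fo; congr (_ + _); exact: mulrC.
Qed.

End LieGroup.

(** * Orbits in the cotangent bundle *)

Section Orbits.
Variables (R : realType) (n : nat) (G : lieGroup R n).
Local Notation V := 'rV[R]_n.
Local Notation e := (lie_one G).
Local Notation "x ** y" := (lie_mul G x y) (at level 40, left associativity).
Local Notation inv := (lie_inv G).
Local Notation hG := (lie_atlas G).

Lemma cotangent_atlas : smooth_atlas (cotangent G).
Proof. exact: prod_atlas hG (vect_atlas _). Qed.

Lemma left_triv1 (v : V) : left_triv e v = v.
Proof.
rewrite /left_triv lie_inv1.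
have -> : lie_mul G e = id by apply/funext => x; exact: lie_mul1.
exact: mdiff_id hG.
Qed.

Lemma Ad_linear (g : G) : linear (Ad g).
Proof. by move=> a u v; exact: linearP. Qed.

Lemma pairing_coAd (g : G) (a : 'cV[R]_n) v :
  pairing (coAd g a) v = pairing a (Ad (inv g) v).
Proof.
have lf : linear (fun v => pairing a (Ad (inv g) v) : R^o).
  by move=> c u w; rewrite Ad_linear; exact: linearP.
pose fM := GRing.isLinear.Build R V R _ _ lf.
pose F : {linear V -> R} := HB.pack (fun v => pairing a (Ad (inv g) v)) fM.
exact: (pairing_form_col F v).
Qed.

Lemma coAdM (g h : G) a : coAd (g ** h) a = coAd g (coAd h a).
Proof.
apply: pairing_inj => v.
have E : Ad (inv (g ** h)) v = Ad (inv h) (Ad (inv g) v).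
  by rewrite lie_invM; exact: AdM.
transitivity (pairing a (Ad (inv (g ** h)) v)); first exact: pairing_coAd.
transitivity (pairing (coAd h a) (Ad (inv g) v)).
  by rewrite E; exact/esym/pairing_coAd.
exact/esym/pairing_coAd.
Qed.

Lemma coAd1 a : coAd e a = a.
Proof.
apply: pairing_inj => v; have := pairing_coAd e a v.
by rewrite lie_inv1 Ad1.
Qed.

Lemma coAd0 (g : G) : coAd g 0 = 0.
Proof.
apply: pairing_inj => v; have := pairing_coAd g 0 v.
by rewrite !pairing0l.
Qed.

Lemma coAdK (g : G) a : coAd (inv g) (coAd g a) = a.
Proof. by rewrite -coAdM lie_mulV coAd1. Qed.

Section Tangent.
Variable (L : submanifold (cotangent G)).

Lemma sub_atlas : smooth_atlas L.
Proof. exact: manifold_atlas (sub_manifold L). Qed.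

Lemma sub_incl_mdifferentiable y : mdifferentiable (sub_incl L) y.
Proof.
by have := smooth_mdifferentiable sub_atlas cotangent_atlas y (sub_smooth L).
Qed.

(** A submanifold parametrized by a map p whose composite with the inclusion is a
    section g |-> (g, s g): its tangent space at the identity is known without
    reference to its own charts. *)
Section GraphSection.
Variables (p : G -> L) (s : G -> 'cV[R]_n).
Hypotheses (dp : mdifferentiable p e)
  (ps : forall g, sub_incl L (p g) = (g, s g)).

Let phi := chart_map G e.
Let psi := chart_inv G e.
Let o : V := phi e.
Let dF : differentiable (fun u => (phi (psi u), s (psi u))) o.
Proof.
have [_] := mdifferentiable_comp hG sub_atlas dp (sub_incl_mdifferentiable _).
rewrite /chart_expr.
have -> : sub_incl L \o p = fun g => (g, s g) by apply/funext => g; exact: ps.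
by [].
Qed.

Lemma section_differentiable : differentiable (s \o psi) o.
Proof.
have d := differentiable_comp dF (ex_diff (is_diff_def := is_diff_snd _)).
exact: d.
Qed.

Lemma section_tangent v :
  mdiff (sub_incl L) (p e) (mdiff p e v) = (v, 'd (s \o psi) o v).
Proof.
have := mdiff_comp hG sub_atlas v dp (sub_incl_mdifferentiable _).
move=> <-; rewrite /mdiff.
have -> : sub_incl L \o p = fun g => (g, s g) by apply/funext => g; exact: ps.
have ds := section_differentiable.
have d1 : is_diff o (fun u => phi (psi u)) id.
  apply: (near_eq_is_diff (f := id)).
  by apply: filterS (near_chart_invK hG (lie_dom e)) => u /esym.
have d := is_diff_pair d1 (differentiableP ds).
exact: is_diffE v d.
Qed.

(** At the identity the trivialization of the tangent bundle is trivial
    ([left_triv1]), which is why the form is evaluated there. *)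
Lemma section_isotropic : isotropic L -> forall v w,
  pairing ('d (s \o psi) o w) v - pairing ('d (s \o psi) o v) w
    + pairing (s e) (lie_bracket G v w) = 0.
Proof.
move=> iso v w.
have := iso (p e) (mdiff p e v) (mdiff p e w).
by rewrite !section_tangent ps /omega /= !left_triv1.
Qed.
End GraphSection.

Hypothesis L0 : forall y : L, (sub_incl L y).2 = 0.

Lemma zero_tangent y w : (mdiff (sub_incl L) y w).2 = 0.
Proof.
have [_ d] := sub_incl_mdifferentiable y.
have s := is_diff_snd (chart_expr (sub_incl L) y (sub_incl L y) (chart_map L y y)).
rewrite /mdiff.
have := is_diffE w (is_diff_comp (differentiableP d) s).
move=> /= <-.
apply: (@is_diffE _ _ _ _ (0 : 'rV[R]_(sub_dim L) -> 'cV[R]_n)).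
have -> : snd \o chart_expr (sub_incl L) y (sub_incl L y) = cst 0.
  by apply/funext => u /=; exact: L0.
exact: is_diff_cst.
Qed.

Lemma zero_isotropic : isotropic L.
Proof.
move=> y w1 w2; rewrite /omega !zero_tangent L0 !pairing0l.
by rewrite subr0 addr0.
Qed.

(** Two injective linear maps, in opposite directions, between the tangent spaces
    of L and of G. *)
Lemma zero_dim (p : G -> L) (s : G -> 'cV[R]_n) : mdifferentiable p e ->
  (forall g, sub_incl L (p g) = (g, s g)) -> sub_dim L = n.
Proof.
move=> dp ps; apply/eqP; rewrite eqn_leq; apply/andP; split.
  pose f w := (mdiff (sub_incl L) (p e) w).1.
  apply: (@injective_linear_leq R _ _ f).
    move=> a u v; by rewrite /f /mdiff linearP.
  move=> u v uv; apply: (@sub_immersion _ _ _ L (p e)).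
  rewrite [LHS]surjective_pairing [RHS]surjective_pairing !zero_tangent.
  by congr pair.
apply: (@injective_linear_leq R _ _ (mdiff p e)).
  by move=> a u v; exact: linearP.
move=> u v uv.
have := section_tangent dp ps u; rewrite uv (section_tangent dp ps).
by case.
Qed.
End Tangent.

(** ** The orbits of the two actions *)

Lemma orbit_left0 (g : G) :
  orbit_of (@left_action R n G) ((g, 0) : cotangent G) = zero_section G.
Proof.
apply/seteqP; split=> [q [k _ <-]//|[k a] /= a0].
by exists (k ** inv g) => //; rewrite /left_action /= -lie_mulA lie_mulV lie_mulr1 -a0.
Qed.

Lemma orbit_right0 (g : G) :
  orbit_of (@right_action R n G) ((g, 0) : cotangent G) = zero_section G.
Proof.
apply/seteqP; split=> [q [k _ <-]|[k a] /= a0].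
  by rewrite /zero_section /right_action /= coAd0.
exists (inv k ** g) => //; rewrite /right_action /= coAd0 lie_invM lie_invK.
by rewrite lie_mulA lie_mulrV lie_mul1 -a0.
Qed.

(** The action on the first component is simply transitive, so the orbit map can
    be reparametrized to make its first component the identity of G. *)
Lemma left_orbit_section (h : G) (a : 'cV[R]_n) (L : submanifold (cotangent G)) :
  is_orbit (@left_action R n G) ((h, a) : cotangent G) L ->
  exists p : G -> L, mdifferentiable p e /\
    forall g, sub_incl L (p g) = (g, a).
Proof.
move=> [_ [pi [spi piE]]]; exists (pi \o (fun g => g ** inv h)); split.
  have dr := smooth_mdiffG e (smooth_rmul (inv h)).
  have := smooth_mdifferentiable hG (sub_atlas L) (e ** inv h) spi.
  exact: (mdifferentiable_comp hG hG dr).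
by move=> g; rewrite /= piE /left_action /= -lie_mulA lie_mulV lie_mulr1.
Qed.

Lemma right_orbit_section (h : G) (a : 'cV[R]_n) (L : submanifold (cotangent G)) :
  is_orbit (@right_action R n G) ((h, a) : cotangent G) L ->
  exists p : G -> L, mdifferentiable p e /\
    forall g, sub_incl L (p g) = (g, coAd (inv g) (coAd h a)).
Proof.
move=> [_ [pi [spi piE]]].
exists (pi \o (fun g => inv g ** h)); split.
  have di := smooth_mdiffG e (lie_smooth_inv G).
  have dr := smooth_mdiffG (inv e) (smooth_rmul h).
  have d := mdifferentiable_comp hG hG di dr.
  have := smooth_mdifferentiable hG (sub_atlas L) (inv e ** h) spi.
  exact: (mdifferentiable_comp hG hG d).
move=> g; rewrite /= piE /right_action /= coAdM lie_invM lie_invK.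
by rewrite lie_mulA lie_mulrV lie_mul1.
Qed.

(** The section is constant, so only the bracket term of the form remains. *)
Lemma left_isotropic_eq0 (h : G) (a : 'cV[R]_n) (L : submanifold (cotangent G)) :
  semisimple G -> is_orbit (@left_action R n G) ((h, a) : cotangent G) L ->
  isotropic L -> a = 0.
Proof.
move=> ss /left_orbit_section[p [dp pE]] iso.
apply: (semisimple_perfect ss) => v w.
have := section_isotropic (s := fun=> a) dp pE iso v w.
have d0 u : 'd ((fun=> a) \o chart_inv G e) (chart_map G e e) u = 0.
  exact: is_diffE u (is_diff_cst a _).
by rewrite !d0 !pairing0l subr0 add0r.
Qed.

(** With s g = Ad^*(g^-1) b the pairing of ds v with w is b ([v, w]), so the three
    terms of the form at (v, w) are b ([w, v]) - b ([v, w]) + b ([v, w]). *)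
Lemma right_isotropic_eq0 (h : G) (a : 'cV[R]_n) (L : submanifold (cotangent G)) :
  semisimple G -> is_orbit (@right_action R n G) ((h, a) : cotangent G) L ->
  isotropic L -> a = 0.
Proof.
move=> ss /right_orbit_section[p [dp pE]] iso.
set b := coAd h a in pE.
suff b0 : b = 0 by rewrite -(coAdK h a) -/b b0 coAd0.
apply: (semisimple_perfect ss) => v w.
pose s g := coAd (inv g) b.
have sE g u : pairing (s g) u = pairing b (Ad g u).
  by have := pairing_coAd (inv g) b u; rewrite lie_invK.
have ds := section_differentiable (s := s) dp pE.
have dsE u u' : pairing ('d (s \o chart_inv G e) (chart_map G e e) u) u' =
    pairing b (lie_bracket G u u').
  have d1 := is_diff_comp (differentiableP ds) (is_diff_pairingl u' _).
  have d2 := is_diff_pairing_Ad G b u'.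
  rewrite -(is_diffE u d2).
  have E : (fun c => pairing c u') \o (s \o chart_inv G e) =
    fun x => pairing b (Ad (chart_inv G e x) u').
    by apply/funext => x; exact: sE.
  by have := is_diffE u d1; rewrite E => ->.
have E := section_isotropic (s := s) dp pE iso w v.
have sEe u : pairing (s e) u = pairing b u.
  by have := sE e u; rewrite Ad1.
have cancel (x y z x' y' : R) :
    x = x' -> y = y' -> z = y' -> x - y + z = 0 -> x' = 0.
  by move=> -> -> ->; rewrite subrK.
exact: cancel (dsE v w) (dsE w v) (sEe (lie_bracket G w v)) E.
Qed.

(** ** The zero section as an orbit *)

Lemma smooth_zero (f : G -> G) :
  smooth_map f -> smooth_map (N := cotangent G) (fun x : G => (f x, 0)).
Proof.
move=> [cf sf]; split=> [x|x y k].
  exact: (continuous_pair (cf x) (g := cst (0 : 'cV[R]_n)) (cvg_cst _)).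
have oU := chart_expr_open hG hG x y.1 cf.
have := Ck_pair oU (sf x y.1 k) (Ck_cst k _ (0 : 'cV[R]_n)).
by apply: Ck_sub => u [z [Dz [/= D1 _]] <-]; exists z.
Qed.

(** The zero section parametrized by a diffeomorphism [f] of G.  The choice of [f]
    adapts the parametrization to the action whose orbit it is. *)
Definition zero_submanifold (f k : G -> G) (sf : smooth_map f)
    (sk : smooth_map k) (fK : cancel f k) : submanifold (cotangent G).
Proof.
apply: (@Submanifold R _ (cotangent G) n G (fun x => (f x, 0))).
- exact: lie_manifold.
- exact: smooth_zero.
- by move=> x y [/(can_inj fK)].
- move=> x u v.
  have df := smooth_mdiffG x sf.
  have E w : mdiff (N := cotangent G) (fun x : G => (f x, 0)) x w =
      (mdiff f x w, 0).
    have [_ d] := df.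
    have dp := is_diff_pair (differentiableP d) (is_diff_cst (0 : 'cV[R]_n) _).
    exact: is_diffE w dp.
  rewrite !E => -[uv].
  have K w : mdiff k (f x) (mdiff f x w) = w.
    have := mdiff_comp hG hG w df (smooth_mdiffG (f x) sk).
    have -> : k \o f = id by apply/funext.
    by rewrite (mdiff_id _ _ hG) => <-.
  by rewrite -(K u) uv K.
Defined.

Lemma left_orbit_exists (g : G) : exists L : submanifold (cotangent G),
  is_orbit (@left_action R n G) ((g, 0) : cotangent G) L.
Proof.
have si := smooth_id hG.
exists (zero_submanifold si si (fun=> erefl)); split.
  rewrite orbit_left0; apply/seteqP; split=> [q [x _ <-]//|[x a] /= a0].
  by exists x => //=; rewrite -a0.
exists (fun x : G => x ** g); split=> //; exact: smooth_rmul.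
Qed.

(** The orbit map of the right action, k |-> g k^-1, is the smooth map
    k |-> k g^-1 followed by the inversion, which serves as parametrization. *)
Lemma right_orbit_exists (g : G) : exists L : submanifold (cotangent G),
  is_orbit (@right_action R n G) ((g, 0) : cotangent G) L.
Proof.
have si := lie_smooth_inv G.
exists (zero_submanifold si si (@lie_invK R n G)); split.
  rewrite orbit_right0; apply/seteqP; split=> [q [x _ <-]//|[x a] /= a0].
  by exists (inv x) => //=; rewrite lie_invK -a0.
exists (fun x : G => x ** inv g); split; first exact: smooth_rmul.
by move=> k /=; rewrite /right_action /= coAd0 lie_invM lie_invK.
Qed.

Lemma zero_section_isotopic : hamiltonian_isotopic (zero_section G) (zero_section G).
Proof.
exists (fun=> 0), snd; split; last first.
  by apply/seteqP; split=> [q [x ? <-]//|x ?]; exists x.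
have hC := cotangent_atlas.
split=> //.
- split=> [x|x y k]; first exact: cvg_cst.
  exact: Ck_cst.
- split=> [x|x y k]; first exact: cvg_snd.
  have oD : open (chart_dom (cotangent G) y) by have [/(_ y)[]] := hC.
  have oU := chart_open_image hC x.2 oD.
  have [_ _ /(_ x.2 y k) ck] := hC.
  have := Ck_comp_affine (A := @snd R^o (V * 'cV[R]_n)%type) oU (@is_diff_snd _ _ _) ck.
  by apply: Ck_sub => u [z [[_ D2] D] <-]; exists z.2.
- by move=> t; exists id; split=> //; exact: smooth_id hC.
- move=> t x w.
  have -> : mdiff (M := real_line R) (N := cotangent G) (fun=> x) t 1 = 0.
    exact: (is_diffE (V := R^o) (1 : R^o) (is_diff_cst _ _)).
  have -> : mdiff (M := cotangent G) (N := real_line R) (fun=> 0) x w = 0.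
    exact: (is_diffE (W := R^o) w (is_diff_cst _ _)).
  have t0 : left_triv x.1 0 = 0 by exact: linear0.
  rewrite /omega /= t0 lie_bracket0l pairing0l subr0.
  have p0 (a : 'cV[R]_n) : pairing a 0 = 0 by exact: linear0.
  by rewrite !p0 addr0.
Qed.

End Orbits.

Theorem corollary3p2 (R : realType) (n : nat) (G : lieGroup R n)
    (hconn : connected [set: G]) (hss : semisimple G)
    (act : G -> cotangent G -> cotangent G)
    (hact : act = @left_action R n G \/ act = @right_action R n G) :
  (forall (x : cotangent G) (L : submanifold (cotangent G)),
     is_orbit act x L ->
     (isotropic L <->
      exists g : G, orbit_of act x = orbit_of act ((g, 0) : cotangent G))) /\
  (forall g : G,
     [/\ exists L : submanifold (cotangent G),
           is_orbit act ((g, 0) : cotangent G) L,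
         forall L : submanifold (cotangent G),
           is_orbit act ((g, 0) : cotangent G) L -> lagrangian L &
         hamiltonian_isotopic (orbit_of act ((g, 0) : cotangent G))
           (zero_section G)]).
Proof.
have orbit0 g : orbit_of act ((g, 0) : cotangent G) = zero_section G.
  by case: hact => ->; [exact: orbit_left0|exact: orbit_right0].
have iso0 x g (L : submanifold (cotangent G)) : is_orbit act x L ->
    orbit_of act x = orbit_of act ((g, 0) : cotangent G) ->
    forall y : L, (sub_incl L y).2 = 0.
  move=> [rE _] xg y.
  have : zero_section G (sub_incl L y) by rewrite -(orbit0 g) -xg -rE; exists y.
  by [].
split=> [[h a] L oL|g].
  split=> [iso|[g xg]]; last exact: zero_isotropic (iso0 _ _ _ oL xg).
  exists h; suff -> : a = 0 by [].
  case: hact => E; rewrite E in oL.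
    exact: left_isotropic_eq0 hss oL iso.
  exact: right_isotropic_eq0 hss oL iso.
split.
- by case: hact => ->; [exact: left_orbit_exists|exact: right_orbit_exists].
- move=> L oL; have L0 := iso0 _ g L oL erefl.
  split; first exact: zero_isotropic.
  have -> : sub_dim L = n.
    case: hact => E; rewrite E in oL.
      by have [p [dp pE]] := left_orbit_section oL; exact: zero_dim dp pE.
    by have [p [dp pE]] := right_orbit_section oL;
      exact: (zero_dim L0 (s := fun g => coAd (lie_inv G g) _) dp pE).
  by rewrite mul2n addnn.
- by rewrite orbit0; exact: zero_section_isotopic.
Qed.
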